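(* If $n\ge 7$ is an integer and $\mathcal{F}\subseteq\binom{[n]}{3}$ is a non-trivial intersecting family, then $\delta(\mathcal{F})\le\delta(\mathcal{HM}_{n,3})=3$.
   Context: $[n]=\{1,2,\dots,n\}$, and $\binom{[n]}{k}$ denotes the family of all $k$-element subsets of $[n]$. A family $\mathcal{F}$ of sets is intersecting if $A\cap B\ne\emptyset$ for all $A,B\in\mathcal{F}$. A full star is a family consisting of all the $k$-subsets of $[n]$ that contain a fixed element. An intersecting family is trivial if it is a subfamily of a full star (i.e. all its members share a common element), and non-trivial otherwise. For $x\in[n]$, the degree of $x$ in $\mathcal{F}\subseteq\binom{[n]}{k}$ is $d_{\mathcal{F}}(x)=|\{F\in\mathcal{F}: x\in F\}|$, and $\delta(\mathcal{F})=\min_{x\in[n]} d_{\mathcal{F}}(x)$ is the minimum degree. The family $\mathcal{HM}_{n,k}$ (defined up to relabelling of $[n]$; here used with $k=3$) consists of a $k$-set $S\subseteq[n]$ together with all $k$-subsets of $[n]$ that contain a fixed element $x\in[n]\setminus S$ and at least one element of $S$. *)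

(* Defs.v *)
From mathcomp Require Import all_boot.
Set Implicit Arguments.
Unset Strict Implicit.
Unset Printing Implicit Defensive.

Section Families.
Variables (T : finType) (k : nat).
Implicit Types (x : T) (S : {set T}) (F : {set {set T}}).

Definition ksubsets : {set {set T}} := [set A : {set T} | #|A| == k].

(* A and B may coincide, so the empty set is in no intersecting family. *)
Definition intersecting F : Prop :=
  forall A B, A \in F -> B \in F -> A :&: B != set0.

Definition full_star x : {set {set T}} := [set A in ksubsets | x \in A].

Definition trivial_family F : Prop := exists x, F \subset full_star x.

Definition nontrivial_intersecting F : Prop :=
  intersecting F /\ ~ trivial_family F.

Definition degree F x : nat := #|[set A in F | x \in A]|.

(* A degree is at most #|F|, so for a nonempty ground set T the initial value
   #|F| does not affect the minimum. *)
Definition min_degree F : nat := \big[minn/#|F|]_(x : T) degree F x.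

Definition HM_family S x : {set {set T}} :=
  S |: [set A in ksubsets | (x \in A) && (A :&: S != set0)].

(* HM_{n,k} is defined up to relabelling: every choice of S and x qualifies. *)
Definition is_HM F : Prop :=
  exists S x, [/\ S \in ksubsets, x \notin S & F = HM_family S x].

End Families.

Arguments ksubsets : clear implicits.

(* Main.v *)
Require Import Defs.
From mathcomp Require Import all_boot all_order.
From mathcomp Require Import zify.

Set Implicit Arguments.
Unset Strict Implicit.
Unset Printing Implicit Defensive.

(** Suppose that the family F of triples is intersecting and has no point common
    to all its members. A single point of degree at most 3 is found by looking at
    links, which are graphs. For a set C meeting every member of F and a in C,
    the link of a consists of the pairs E disjoint from C with a |: E in F; the
    links of distinct points of C are cross-intersecting, since F is
    intersecting.

    If some pair {a, b} meets every member of F, the two links are nonempty, and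
    outside {a, b} the degree of u in F is at most the sum of its degrees in the
    two links, plus 1 for the triple {a, b, u}. Among five points, two nonempty
    cross-intersecting graphs always have one of total degree at most 2
    (two_graphs).

    Otherwise take any C in F. Each of its three points has a nonempty link,
    because no pair of points of C meets all of F. A member of F through a point
    u outside C meets C either in one point a, and is then an edge at u of the
    link of a, or in C minus a point a, and is then the triple C :\ a with u
    added. This last triple must meet every triple a |: E coming from the link of
    a, which forces u to lie on all edges E of that link. Hence the degree of u
    in F is at most the sum over a in C of the weight of u in the link of a: the
    degree plus 1 if u lies on all edges. Among any four points, three nonempty
    pairwise cross-intersecting graphs leave one of total weight at most 3
    (three_graphs).

    Both graph statements rest on one trichotomy: a nonempty graph contains two
    disjoint edges, or a triangle, or it is a star. In the first two cases the
    other graphs live on the at most four vertices involved, so any further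
    vertex is light. For three graphs there may be no further vertex when two
    disjoint edges occur; a light vertex is then found on these edges
    (square_light_vertex). Stars have degree at most 1 away from their centres.

    The Hilton-Milner family attains 3: a point u outside S and different from x
    is exactly in the triples {x, u, s} with s in S. *)

(** * Cross-intersecting graphs *)

Section Graphs.
Variable T : finType.
Implicit Types (u v w x y z t : T) (E U W : {set T}) (A B D G H : {set {set T}}).

Definition cross_intersecting G H : Prop :=
  forall E E', E \in G -> E' \in H -> E :&: E' != set0.

Definition kernel G : {set T} := \bigcap_(E in G) E.

(** The bonus for lying on all edges pays for the triples that meet a fixed
    member of the family in two points; see card_trace2. *)
Definition weight G u : nat := degree G u + (u \in kernel G).

Lemma cross_intersecting_sym G H :
  cross_intersecting G H -> cross_intersecting H G.
Proof. by move=> cGH E E' EH E'G; rewrite setIC cGH. Qed.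

Lemma edge_eq E u x : #|E| = 2 -> u \in E -> x \in E -> u != x -> E = [set u; x].
Proof.
move=> E2 uE xE nux; apply/esym/eqP; rewrite eqEcard cards2 nux E2 leqnn andbT.
by apply/subsetP=> y; rewrite !inE => /orP[] /eqP->.
Qed.

Lemma ksubsets_card G k E : G \subset ksubsets T k -> E \in G -> #|E| = k.
Proof. by move=> /subsetP sG /sG; rewrite inE => /eqP. Qed.

Lemma meets_pair E x y : E :&: [set x; y] != set0 -> (x \in E) || (y \in E).
Proof.
case/set0Pn=> z; rewrite !inE => /andP[zE] /orP[] /eqP <-; rewrite zE ?orbT //.
Qed.

Lemma cross_pair G H E x y : cross_intersecting G H -> E \in G ->
  [set x; y] \in H -> (x \in E) || (y \in E).
Proof. by move=> cGH EG xyH; apply/meets_pair/cGH. Qed.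

Lemma weight_missed G u E : E \in G -> u \notin E -> weight G u = degree G u.
Proof.
move=> EG uE; rewrite /weight; case: bigcapP => [/(_ E EG)|_]; last by rewrite addn0.
by rewrite (negPf uE).
Qed.

Lemma weight_off G u : G != set0 -> {in G, forall E, u \notin E} ->
  weight G u = 0.
Proof.
move=> /set0Pn[E EG] uG; rewrite (weight_missed EG (uG E EG)).
apply/eqP; rewrite cards_eq0; apply/eqP/setP=> E'; rewrite !inE.
by apply/andP=> -[/uG/negP].
Qed.

(** If [set x; y] is an edge of H, an edge of G at u leads to x or y; keeping
    the two membership bits, and not only the bound 2, lets further crossing
    constraints switch them off. *)
Lemma degree_le_cross G H u x y : G \subset ksubsets T 2 ->
  cross_intersecting G H -> [set x; y] \in H -> u != x -> u != y ->
  degree G u <= ([set u; x] \in G) + ([set u; y] \in G).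
Proof.
move=> sG cGH xyH nux nuy.
have star E0 : #|[set E in G | E == E0]| <= (E0 \in G).
  case E0G: (E0 \in G).
    rewrite -[leqRHS]/1 -(cards1 E0).
    by apply/subset_leq_card/subsetP=> E; rewrite !inE => /andP[].
  rewrite leqn0 cards_eq0; apply/eqP/setP=> E; rewrite !inE.
  by case: eqP => [->|]; rewrite ?E0G ?andbF.
apply: leq_trans (leq_add (star _) (star _)).
apply: leq_trans (leq_card_setU _ _).
apply/subset_leq_card/subsetP=> E; rewrite !inE => /andP[EG uE]; rewrite EG /=.
have E2 := ksubsets_card sG EG.
case/orP: (cross_pair cGH EG xyH) => [xE|yE].
  by rewrite (edge_eq E2 uE xE nux) eqxx.
by rewrite (edge_eq E2 uE yE nuy) eqxx orbT.
Qed.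

Lemma card2_set2 E : #|E| = 2 -> exists x y, x != y /\ E = [set x; y].
Proof. by move/eqP/cards2P. Qed.

Lemma set2_notin u x y : (u \notin [set x; y]) = (u != x) && (u != y).
Proof. by rewrite !inE negb_or. Qed.

Lemma degree_le2 G H E u : G \subset ksubsets T 2 -> H \subset ksubsets T 2 ->
  cross_intersecting G H -> E \in H -> u \notin E -> degree G u <= 2.
Proof.
move=> sG sH cGH EH; have [x [y [_ eE]]] := card2_set2 (ksubsets_card sH EH).
rewrite {E}eE in EH *; rewrite set2_notin => /andP[nux nuy].
apply: leq_trans (degree_le_cross sG cGH EH nux nuy) _.
by do 2!case: (_ \in _).
Qed.

Lemma cross_pair_disjoint G H x y z t : cross_intersecting G H ->
  uniq [:: x; y; z; t] -> [set x; y] \in G -> [set z; t] \notin H.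
Proof.
rewrite /= !inE !negb_or => cGH /and4P[/and3P[_ nxz nxt] /andP[nyz nyt] _ _] xyG.
apply/negP=> /(cross_pair cGH xyG).
by rewrite !inE !(eq_sym _ x) !(eq_sym _ y) (negPf nxz) (negPf nxt)
  (negPf nyz) (negPf nyt).
Qed.

(** A graph crossing G is confined to the vertices of W. *)
Definition traps G W : Prop :=
  (exists2 E, E \in G & E \subset W) /\
  (forall E, #|E| = 2 -> {in G, forall E', E :&: E' != set0} -> E \subset W).

Lemma edge_subset E W x y : #|E| = 2 -> x != y -> x \in E -> y \in E ->
  x \in W -> y \in W -> E \subset W.
Proof.
move=> E2 nxy xE yE xW yW; rewrite (edge_eq E2 xE yE nxy).
by apply/subsetP=> z; rewrite !inE => /orP[] /eqP->.
Qed.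

Lemma triangle_traps G x y z : x != y -> y != z -> x != z ->
  [set x; y] \in G -> [set y; z] \in G -> [set x; z] \in G ->
  traps G [set x; y; z].
Proof.
move=> nxy nyz nxz xyG yzG xzG; split.
  by exists [set x; y] => //; apply/subsetP=> t; rewrite !inE => ->.
move=> E E2 mE.
have /orP h1 := meets_pair (mE _ xyG); have /orP h2 := meets_pair (mE _ yzG).
have /orP h3 := meets_pair (mE _ xzG).
have sW p q : p != q -> p \in E -> q \in E ->
    p \in [set x; y; z] -> q \in [set x; y; z] -> E \subset [set x; y; z].
  exact: edge_subset.
case: h1 => [xE|yE]; case: h2 => [yE'|zE].
- by apply: sW nxy xE yE' _ _; rewrite !inE eqxx ?orbT.
- by apply: sW nxz xE zE _ _; rewrite !inE eqxx ?orbT.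
- case: h3 => [xE|zE].
    by apply: sW nxy xE yE _ _; rewrite !inE eqxx ?orbT.
  by apply: sW nyz yE zE _ _; rewrite !inE eqxx ?orbT.
- by apply: sW nyz yE zE _ _; rewrite !inE eqxx ?orbT.
Qed.

Lemma square_traps G u v w z : uniq [:: u; v; w; z] ->
  [set u; v] \in G -> [set w; z] \in G -> traps G [set u; v; w; z].
Proof.
rewrite /= !inE !negb_or => /and4P[/and3P[nuv nuw nuz] /andP[nvw nvz] nwz _] uvG wzG.
split; first by exists [set u; v] => //; apply/subsetP=> t; rewrite !inE => ->.
move=> E E2 mE.
have /orP h1 := meets_pair (mE _ uvG); have /orP h2 := meets_pair (mE _ wzG).
have sW p q : p != q -> p \in E -> q \in E -> p \in [set u; v; w; z] ->
    q \in [set u; v; w; z] -> E \subset [set u; v; w; z].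
  exact: edge_subset.
case: h1 => pE; case: h2 => qE; apply: sW pE qE _ _ => //;
  by rewrite !inE eqxx ?orbT.
Qed.

(** H has no edge at t. Neither does the edge of G inside W contain t, so t is not
    in the kernel of G, and an edge of H, which avoids t, bounds its degree. *)
Lemma outside_trap G H W t : G \subset ksubsets T 2 -> H \subset ksubsets T 2 ->
  H != set0 -> cross_intersecting G H -> traps G W -> t \notin W ->
  weight G t <= 2 /\ weight H t = 0.
Proof.
move=> sG sH H0 cGH [[E EG EW] trap] tW.
have offH : {in H, forall E', t \notin E'}.
  move=> E' E'H; apply: contra tW; apply/subsetP/trap.
    exact: ksubsets_card sH E'H.
  by move=> E2 E2G; apply: cross_intersecting_sym cGH _ _ _ _.
split; last exact: weight_off.
rewrite (weight_missed EG); last by apply: contra tW; apply/subsetP.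
have /set0Pn[E' E'H] := H0.
exact: (degree_le2 sG sH cGH E'H (offH E' E'H)).
Qed.

(** A single edge is kept apart: its kernel has two points, both of weight 2,
    whereas a star with more edges has a single centre and weight at most 1
    elsewhere. *)
Definition starlike G : Prop :=
  (#|kernel G| <= 1 /\ forall u, u \notin kernel G -> weight G u <= 1)
  \/ exists x y, G = [set [set x; y]].

Variant graph_shape G : Prop :=
| HasSquare u v w z of uniq [:: u; v; w; z]
    & [set u; v] \in G & [set w; z] \in G
| HasTriangle x y z of x != y & y != z & x != z
    & [set x; y] \in G & [set y; z] \in G & [set x; z] \in G
| IsStar of starlike G.

(** Without disjoint edges, two different edges share at most one point, so the
    kernel of G has at most one. A vertex u off the kernel is missed by some edge
    {x, y}, so its edges are among {u, x} and {u, y}; having both would close a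
    triangle. *)
Lemma graph_shapeP G : G \subset ksubsets T 2 -> G != set0 -> graph_shape G.
Proof.
move=> sG G0.
case: (boolP [exists E in G, exists E' in G, E :&: E' == set0]).
  case/exists_inP=> E EG /exists_inP[E' E'G /eqP dE].
  have [u [v [nuv eE]]] := card2_set2 (ksubsets_card sG EG).
  have [w [z [nwz eE']]] := card2_set2 (ksubsets_card sG E'G).
  subst E E'; apply: (@HasSquare G u v w z) => //=.
  have nu: u \notin [set w; z].
    by apply: contra_eqN dE => h; apply/set0Pn; exists u; rewrite in_setI h !inE eqxx.
  have nv: v \notin [set w; z].
    by apply: contra_eqN dE => h; apply/set0Pn; exists v; rewrite in_setI h !inE eqxx orbT.
  by move: nu nv; rewrite !inE !negb_or nuv nwz => -> ->.
rewrite negb_exists_in => /forall_inP nosq.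
have cGG : cross_intersecting G G.
  by move=> E E' /nosq; rewrite negb_exists_in => /forall_inP h /h.
case: (boolP [exists x, exists y, exists z, [&& x != y, y != z, x != z,
   [set x; y] \in G, [set y; z] \in G & [set x; z] \in G]]).
  case/existsP=> x /existsP[y /existsP[z /and5P[h1 h2 h3 h4 /andP[h5 h6]]]].
  exact: (@HasTriangle G x y z).
move/existsPn=> notri; apply: IsStar.
case: (leqP #|G| 1) => [G1|].
  have /eqP/cards1P[E eG] : #|G| = 1 by apply/eqP; rewrite eqn_leq G1 card_gt0.
  right; have EG : E \in G by rewrite eG inE.
  have [x [y [_ eE]]] := card2_set2 (ksubsets_card sG EG).
  by exists x, y; rewrite eG eE.
case/card_gt1P=> E1 [E2 [E1G E2G nE]]; left.
split.
  apply/card_le1_eqP => x y /bigcapP xG /bigcapP yG.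
  apply: contraNeq nE => nxy.
  rewrite (edge_eq (ksubsets_card sG E1G) (xG _ E1G) (yG _ E1G)) 1?eq_sym //.
  by rewrite (edge_eq (ksubsets_card sG E2G) (xG _ E2G) (yG _ E2G)) 1?eq_sym.
move=> u uK; have /exists_inP[E EG uE] : [exists E in G, u \notin E].
  rewrite -negb_forall_in; apply: contra uK => /forall_inP uG.
  exact/bigcapP.
rewrite (weight_missed EG uE).
have [x [y [nxy eE]]] := card2_set2 (ksubsets_card sG EG).
subst E; move: uE; rewrite set2_notin => /andP[nux nuy].
apply: leq_trans (degree_le_cross sG cGG EG nux nuy) _.
have /existsPn/(_ x)/existsPn/(_ y) := notri u.
by rewrite nux nuy nxy EG /=; do 2!case: (_ \in G).
Qed.

Lemma exists_outside U W : #|W| < #|U| -> exists2 t, t \in U & t \notin W.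
Proof.
move=> ltWU; have /subsetPn[t tU tW] : ~~ (U \subset W).
  by apply: contraL ltWU => /subset_leq_card; rewrite -leqNgt.
by exists t.
Qed.

Lemma card_setU_le E W a b : #|E| <= a -> #|W| <= b -> #|E :|: W| <= a + b.
Proof.
move=> ha hb; apply: leq_trans (leq_card_setU _ _) _; exact: leq_add.
Qed.

Lemma card_set2_le x y : #|[set x; y]| <= 2.
Proof. by rewrite cards2; case: (_ != _). Qed.

Lemma card_set3 x y z : x != y -> z != x -> z != y -> #|[set x; y; z]| = 3.
Proof.
by move=> nxy nzx nzy; rewrite setUC cardsU1 cards2 nxy !inE negb_or nzx nzy.
Qed.

Lemma card_set3_le x y z : #|[set x; y; z]| <= 3.
Proof. by apply: (@card_setU_le _ _ 2 1); rewrite ?card_set2_le ?cards1. Qed.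

Lemma card_set4_le u v w z : #|[set u; v; w; z]| <= 4.
Proof. by apply: (@card_setU_le _ _ 3 1); rewrite ?card_set3_le ?cards1. Qed.

Lemma degree_le_weight G u : degree G u <= weight G u.
Proof. exact: leq_addr. Qed.

Lemma weight_single x y u : weight [set [set x; y]] u = (u \in [set x; y]).*2.
Proof.
case: (boolP (u \in [set x; y])) => uE; last first.
  rewrite weight_off //; first by apply/set0Pn; exists [set x; y]; rewrite inE.
  by move=> E; rewrite inE => /eqP->.
rewrite /weight /degree.
have ->: [set E in [set [set x; y]] | u \in E] = [set [set x; y]].
  by apply/setP=> E; rewrite !inE; case: eqP => [->|].
rewrite cards1; case: bigcapP => // -[] E; rewrite inE => /eqP-> //.
Qed.

Lemma starlike_degree G : starlike G ->
  exists K : {set T}, #|K| <= 2 /\ forall u, u \notin K -> degree G u <= 1.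
Proof.
case=> [[K1 lK]|[x [y ->]]].
  exists (kernel G); split; first exact: leq_trans K1 _.
  by move=> u /lK; apply: leq_trans; apply: degree_le_weight.
exists [set x; y]; split; first exact: card_set2_le.
by move=> u uE; apply: leq_trans (degree_le_weight _ _) _;
  rewrite weight_single (negPf uE).
Qed.

(** If both graphs are stars, their exceptional sets (the centre, or the only
    edge) have together at most four points, so some vertex of U has degree at
    most 1 in each. Otherwise one graph confines the other to four points. *)
Lemma two_graphs G H U : G \subset ksubsets T 2 -> H \subset ksubsets T 2 ->
  G != set0 -> H != set0 -> cross_intersecting G H -> 4 < #|U| ->
  exists2 u, u \in U & degree G u + degree H u <= 2.
Proof.
have trap G1 H1 W : G1 \subset ksubsets T 2 -> H1 \subset ksubsets T 2 ->
    H1 != set0 -> cross_intersecting G1 H1 -> traps G1 W -> #|W| < #|U| ->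
    exists2 u, u \in U & degree G1 u + degree H1 u <= 2.
  move=> sG sH H0 cGH tG /exists_outside[t tU tW]; exists t => //.
  have [w1 w2] := outside_trap sG sH H0 cGH tG tW.
  have := degree_le_weight G1 t; have := degree_le_weight H1 t; lia.
move=> sG sH G0 H0 cGH U5; have cHG := cross_intersecting_sym cGH.
have sym : (exists2 u, u \in U & degree H u + degree G u <= 2) ->
    exists2 u, u \in U & degree G u + degree H u <= 2.
  by case=> u uU; rewrite addnC; exists u.
have [u v w z un e1 e2|x y z *|kG] := graph_shapeP sG G0.
- apply: trap (square_traps un e1 e2) _ => //.
  by apply: leq_ltn_trans (card_set4_le _ _ _ _) _.
- apply: (@trap _ _ [set x; y; z]) => //; first exact: triangle_traps.
  by apply: leq_ltn_trans (card_set3_le _ _ _) _; apply: ltnW.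
have [u v w z un e1 e2|x y z *|kH] := graph_shapeP sH H0.
- apply/sym; apply: trap (square_traps un e1 e2) _ => //.
  by apply: leq_ltn_trans (card_set4_le _ _ _ _) _.
- apply/sym; apply: (@trap _ _ [set x; y; z]) => //; first exact: triangle_traps.
  by apply: leq_ltn_trans (card_set3_le _ _ _) _; apply: ltnW.
have [K [K2 lK]] := starlike_degree kG; have [L [L2 lL]] := starlike_degree kH.
have [t tU] := exists_outside (leq_ltn_trans (card_setU_le K2 L2) U5).
rewrite inE negb_or => /andP[tK tL]; exists t => //.
exact: (leq_add (lK t tK) (lL t tL)).
Qed.

(** Here the four vertices may be all of U, so no vertex outside a trap is at
    hand. The candidates are v and z, the ends of the disjoint edges of A that
    are missed by the edge {u, w} of B: no further weight than the degree comes
    from A and B there, and {v, z} is excluded from D. *)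
Lemma square_light_vertex A B D u v w z :
  A \subset ksubsets T 2 -> B \subset ksubsets T 2 -> D \subset ksubsets T 2 ->
  D != set0 -> cross_intersecting A B -> cross_intersecting A D ->
  cross_intersecting B D -> uniq [:: u; v; w; z] ->
  [set u; v] \in A -> [set w; z] \in A -> [set u; w] \in B ->
  weight A v + weight B v + weight D v <= 3 \/
  weight A z + weight B z + weight D z <= 3.
Proof.
move=> sA sB sD D0 cAB cAD cBD un uvA wzA uwB.
have cBA := cross_intersecting_sym cAB; have cDA := cross_intersecting_sym cAD.
have cDB := cross_intersecting_sym cBD.
move: un; rewrite /= !inE !negb_or.
case/and4P=> /and3P[nuv nuw nuz] /andP[nvw nvz] nwz _.
have nvu : v != u by rewrite eq_sym.
have nwu : w != u by rewrite eq_sym.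
have nzu : z != u by rewrite eq_sym.
have nwv : w != v by rewrite eq_sym.
have nzv : z != v by rewrite eq_sym.
have nzw : z != w by rewrite eq_sym.
have Av := degree_le_cross sA cAB uwB nvu nvw.
have Az := degree_le_cross sA cAB uwB nzu nzw.
have Bv := degree_le_cross sB cBA wzA nvw nvz.
have Bz := degree_le_cross sB cBA uvA nzu nzv.
have Dv := degree_le_cross sD cDA wzA nvw nvz.
have Dz := degree_le_cross sD cDA uvA nzu nzv.
have [unw vwzu] : uniq [:: u; w; v; z] /\ uniq [:: v; w; z; u].
  by split; rewrite /= !inE !negb_or; do !(apply/andP; split).
have vzD := cross_pair_disjoint cBD unw uwB.
have zvD : [set z; v] \notin D by rewrite setUC.
rewrite (negPf vzD) addn0 in Dv; rewrite (negPf zvD) addn0 in Dz.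
have wAv : weight A v = degree A v.
  by apply: weight_missed wzA _; rewrite set2_notin nvw.
have wAz : weight A z = degree A z.
  by apply: weight_missed uvA _; rewrite set2_notin nzu.
have wBv : weight B v = degree B v.
  by apply: weight_missed uwB _; rewrite set2_notin nvu.
have wBz : weight B z = degree B z.
  by apply: weight_missed uwB _; rewrite set2_notin nzu.
rewrite wAv wAz wBv wBz.
case: (boolP ([set v; w] \in D)) => vwD.
  right.
  (* {v, w} keeps {z, u} out of A and B, and {z, v} is not in D: each graph has
     at most one edge at z. *)
  rewrite (weight_missed vwD) ?set2_notin ?nzv //.
  have zuA := cross_pair_disjoint cDA vwzu vwD.
  have zuB := cross_pair_disjoint cDB vwzu vwD.
  move: Az Bz Dz; rewrite (negPf zuA) (negPf zuB) !add0n.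
  move=> Az1 Bz1 Dz1; apply: leq_trans (leq_add (leq_add Az1 Bz1) Dz1) _.
  by do 3!case: (_ \in _).
left.
have [E ED] := set0Pn _ D0.
have D0v : degree D v = 0 by apply/eqP; rewrite -leqn0 (leq_trans Dv) ?(negPf vwD).
have vE : v \notin E.
  apply/negP=> vE; move/eqP: D0v; rewrite cards_eq0 => /eqP/setP/(_ E).
  by rewrite !inE ED vE.
rewrite (weight_missed ED vE) D0v addn0.
(* Weight 4 at v would put {v, w} in A and {v, z} in B; an edge of D missing v
   would then contain u, w and z. *)
rewrite leqNgt; apply/negP => big.
have [vwA [vwB vzB]] : [set v; w] \in A /\ [set v; w] \in B /\ [set v; z] \in B.
  by move: (leq_trans big (leq_add Av Bv)); do 4!case: (_ \in _).
have uE : u \in E by have := cross_pair cDA ED uvA; rewrite (negPf vE) orbF.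
have wE : w \in E by have := cross_pair cDA ED vwA; rewrite (negPf vE).
have zE : z \in E by have := cross_pair cDB ED vzB; rewrite (negPf vE).
move: zE; rewrite (edge_eq (ksubsets_card sD ED) uE wE nuw) !inE.
by rewrite (negPf nzu) (negPf nzw).
Qed.

Lemma trap_three A B D W t :
  A \subset ksubsets T 2 -> B \subset ksubsets T 2 -> D \subset ksubsets T 2 ->
  B != set0 -> D != set0 -> cross_intersecting A B -> cross_intersecting A D ->
  traps A W -> t \notin W -> weight A t + weight B t + weight D t <= 3.
Proof.
move=> sA sB sD B0 D0 cAB cAD tA tW.
have [wA wB] := outside_trap sA sB B0 cAB tA tW.
have [_ wD] := outside_trap sA sD D0 cAD tA tW.
lia.
Qed.

Lemma square_three_graphs A B D U u v w z :
  A \subset ksubsets T 2 -> B \subset ksubsets T 2 -> D \subset ksubsets T 2 ->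
  B != set0 -> D != set0 -> cross_intersecting A B -> cross_intersecting A D ->
  cross_intersecting B D -> 3 < #|U| -> uniq [:: u; v; w; z] ->
  [set u; v] \in A -> [set w; z] \in A ->
  exists2 t, t \in U & weight A t + weight B t + weight D t <= 3.
Proof.
move=> sA sB sD B0 D0 cAB cAD cBD U4 un uvA wzA.
case: (boolP (U \subset [set u; v; w; z])) => [sU|/subsetPn[t tU tW]]; last first.
  exists t => //.
  exact: (trap_three sA sB sD B0 D0 cAB cAD (square_traps un uvA wzA) tW).
have eU : U = [set u; v; w; z].
  by apply/eqP; rewrite eqEcard sU (leq_trans (card_set4_le _ _ _ _)).
have [uU vU wU zU] : [/\ u \in U, v \in U, w \in U & z \in U].
  by rewrite eU !inE !eqxx ?orbT.
have [E EB] := set0Pn _ B0.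
have cBA := cross_intersecting_sym cAB.
have finish p q : p \in U -> q \in U ->
    weight A p + weight B p + weight D p <= 3 \/
    weight A q + weight B q + weight D q <= 3 ->
    exists2 t, t \in U & weight A t + weight B t + weight D t <= 3.
  by move=> pU qU []; [exists p | exists q].
have E2 := ksubsets_card sB EB.
move: (un); rewrite /= !inE !negb_or.
case/and4P=> /and3P[nuv nuw nuz] /andP[nvw nvz] nwz _.
have neqs := (nuv, nuw, nuz, nvw, nvz, nwz).
have vuA : [set v; u] \in A by rewrite setUC.
have zwA : [set z; w] \in A by rewrite setUC.
case/orP: (cross_pair cBA EB uvA) => pE; case/orP: (cross_pair cBA EB wzA) => qE.
- rewrite (edge_eq E2 pE qE nuw) in EB.
  exact: (finish v z _ _ (square_light_vertex sA sB sD D0 cAB cAD cBD un uvA wzA EB)).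
- rewrite (edge_eq E2 pE qE nuz) in EB.
  apply: (finish v w _ _ (square_light_vertex sA sB sD D0 cAB cAD cBD _ uvA zwA EB)) => //.
  by rewrite /= !inE !negb_or !neqs (eq_sym z) nwz.
- rewrite (edge_eq E2 pE qE nvw) in EB.
  apply: (finish u z _ _ (square_light_vertex sA sB sD D0 cAB cAD cBD _ vuA wzA EB)) => //.
  by rewrite /= !inE !negb_or !neqs (eq_sym v) nuv.
- rewrite (edge_eq E2 pE qE nvz) in EB.
  apply: (finish u w _ _ (square_light_vertex sA sB sD D0 cAB cAD cBD _ vuA zwA EB)) => //.
  by rewrite /= !inE !negb_or !neqs (eq_sym v) (eq_sym z) nuv nwz.
Qed.

Lemma weight_gt0_edge G u : 0 < weight G u -> u \notin kernel G ->
  exists2 E, E \in G & u \in E.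
Proof.
move=> w0 uK; move: w0; rewrite /weight (negPf uK) addn0 card_gt0.
by case/set0Pn=> E; rewrite inE => /andP[EG uE]; exists E.
Qed.

Lemma three_stars A B D U : 3 < #|U| ->
  #|kernel A| <= 1 -> #|kernel B| <= 1 -> #|kernel D| <= 1 ->
  (forall u, u \notin kernel A -> weight A u <= 1) ->
  (forall u, u \notin kernel B -> weight B u <= 1) ->
  (forall u, u \notin kernel D -> weight D u <= 1) ->
  exists2 t, t \in U & weight A t + weight B t + weight D t <= 3.
Proof.
move=> U4 K1 L1 M1 lK lL lM.
have [t tU] : exists2 t, t \in U & t \notin kernel A :|: kernel B :|: kernel D.
  apply: exists_outside; apply: leq_ltn_trans U4.
  by apply: (@card_setU_le _ _ 2 1) => //; apply: (@card_setU_le _ _ 1 1).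
rewrite !inE !negb_or => /andP[/andP[tK tL] tM]; exists t => //.
by have := lK t tK; have := lL t tL; have := lM t tM; lia.
Qed.

(** If the two centres and the ends of the edge fail to exclude a vertex of U,
    they are four distinct points p, q, x, y making up U. When x and y are both
    heavy, A has an edge at x and B has an edge at y; these pass through the
    centres, so {x, p} and {y, q} are disjoint. *)
Lemma two_stars_one_edge A B U x y : 3 < #|U| ->
  A \subset ksubsets T 2 -> B \subset ksubsets T 2 -> cross_intersecting A B ->
  #|kernel A| <= 1 -> #|kernel B| <= 1 ->
  (forall u, u \notin kernel A -> weight A u <= 1) ->
  (forall u, u \notin kernel B -> weight B u <= 1) ->
  exists2 t, t \in U & weight A t + weight B t + weight [set [set x; y]] t <= 3.
Proof.
move=> U4 sA sB cAB K1 L1 lK lL.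
set W := kernel A :|: kernel B :|: [set x; y].
case: (boolP (U \subset W)) => [sU|/subsetPn[t tU]]; last first.
  rewrite (in_setU _ _ [set x; y]) in_setU !negb_or.
  case/andP=> /andP[tK tL] txy; exists t => //.
  by rewrite weight_single (negPf txy); have := lK t tK; have := lL t tL; lia.
have W4 : 3 < #|W| by apply: leq_trans U4 (subset_leq_card sU).
have cW : #|W| <= #|kernel A| + #|kernel B| + 2.
  by apply: card_setU_le (card_set2_le x y); apply: card_setU_le.
have /eqP/cards1P[p eK] : #|kernel A| = 1 by lia.
have /eqP/cards1P[q eL] : #|kernel B| = 1 by lia.
have eU : U = W.
  apply/eqP; rewrite eqEcard sU; apply: leq_trans U4.
  by apply: leq_trans cW _; rewrite eK eL !cards1.
have un : uniq [:: p; q; x; y].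
  apply/card_uniqP; apply/eqP; rewrite eqn_leq card_size /=.
  apply: leq_trans W4 _; rewrite /W eK eL.
  by apply/subset_leq_card/subsetP=> z; rewrite !inE -!orbA.
have uyxp : uniq [:: x; p; y; q].
  move: un; rewrite /= !inE !negb_or !(eq_sym _ x) (eq_sym y q).
  by case/and4P=> /and3P[-> -> ->] /andP[-> ->] -> _.
have [px qx py qy] : [/\ x \notin kernel A, x \notin kernel B,
    y \notin kernel A & y \notin kernel B].
  rewrite eK eL !inE; move: un; rewrite /= !inE !negb_or !(eq_sym x) !(eq_sym y).
  by case/and4P=> /and3P[_ -> ->] /andP[-> ->].
have star_edge G r u : G \subset ksubsets T 2 -> kernel G = [set r] ->
    u \notin kernel G -> 0 < weight G u -> [set u; r] \in G.
  move=> sG eG uG /weight_gt0_edge/(_ uG)[E EG uE].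
  have rE : r \in E by apply: (bigcapP (_ : r \in kernel G)) EG; rewrite eG inE.
  rewrite -(edge_eq (ksubsets_card sG EG) uE rE) //.
  by move: uG; rewrite eG inE.
have [xU yU] : x \in U /\ y \in U by rewrite eU !inE !eqxx !orbT.
case: (leqP (weight A x) 0) => [w0|wx].
  exists x => //; rewrite weight_single !inE eqxx /=.
  by have := lL x qx; lia.
case: (leqP (weight B y) 0) => [w0|wy].
  exists y => //; rewrite weight_single !inE eqxx orbT /=.
  by have := lK y py; lia.
have xpA := star_edge A p x sA eK px wx.
have := cross_pair_disjoint cAB uyxp xpA.
by rewrite (star_edge B q y sB eL qy wy).
Qed.

(** A vertex off the edge {x, y} and off the exceptional points of A has weight at
    most 1 + 0 + 2. These points number at most three: if A is a single edge,
    it shares a point with {x, y}. *)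
Lemma starlike_two_edges A U x y p q : 3 < #|U| -> starlike A ->
  cross_intersecting A [set [set x; y]] ->
  exists2 t, t \in U &
    weight A t + weight [set [set x; y]] t + weight [set [set p; q]] t <= 3.
Proof.
move=> U4 kA cAB.
have [K [K3 lK]] : exists K : {set T}, #|[set x; y] :|: K| <= 3 /\
    forall u, u \notin K -> weight A u <= 1.
  case: kA => [[K1 lK]|[a [b eA]]].
    exists (kernel A); split=> //.
    by apply: (@card_setU_le _ _ 2 1); rewrite ?card_set2_le.
  exists [set a; b]; split; last first.
    by move=> u uab; rewrite eA weight_single (negPf uab).
  have I0 : [set x; y] :&: [set a; b] != set0.
    by rewrite setIC; apply: cAB; rewrite ?eA inE.
  rewrite cardsU; have := card_set2_le x y; have := card_set2_le a b.
  by move: I0; rewrite -card_gt0; lia.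
have [t tU] := exists_outside (leq_ltn_trans K3 U4).
rewrite inE negb_or => /andP[txy tK]; exists t => //.
rewrite !weight_single (negPf txy); have := lK t tK; case: (_ \in _) => /=; lia.
Qed.

(** A trap of three points leaves a vertex of U outside, a trap of four points is
    handled by square_three_graphs, and three starlike graphs are sorted by how
    many of them are single edges. *)
Lemma three_graphs A B D U :
  A \subset ksubsets T 2 -> B \subset ksubsets T 2 -> D \subset ksubsets T 2 ->
  A != set0 -> B != set0 -> D != set0 -> cross_intersecting A B ->
  cross_intersecting A D -> cross_intersecting B D -> 3 < #|U| ->
  exists2 t, t \in U & weight A t + weight B t + weight D t <= 3.
Proof.
move=> sA sB sD A0 B0 D0 cAB cAD cBD U4.
have cBA := cross_intersecting_sym cAB; have cDA := cross_intersecting_sym cAD.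
have cDB := cross_intersecting_sym cBD.
have perm1 G1 G2 G3 :
    (exists2 t, t \in U & weight G1 t + weight G2 t + weight G3 t <= 3) ->
    exists2 t, t \in U & weight G2 t + weight G1 t + weight G3 t <= 3.
  by case=> t tU; rewrite (addnC (weight G1 t)); exists t.
have perm2 G1 G2 G3 :
    (exists2 t, t \in U & weight G1 t + weight G2 t + weight G3 t <= 3) ->
    exists2 t, t \in U & weight G1 t + weight G3 t + weight G2 t <= 3.
  by case=> t tU; rewrite addnAC; exists t.
have trap3 G1 G2 G3 x y z :
  G1 \subset ksubsets T 2 -> G2 \subset ksubsets T 2 ->
  G3 \subset ksubsets T 2 -> G2 != set0 -> G3 != set0 ->
  cross_intersecting G1 G2 -> cross_intersecting G1 G3 ->
  traps G1 [set x; y; z] ->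
  exists2 t, t \in U & weight G1 t + weight G2 t + weight G3 t <= 3.
  move=> s1 s2 s3 n2 n3 c12 c13 tr.
  have [t tU tW] := exists_outside (leq_ltn_trans (card_set3_le x y z) U4).
  by exists t => //; apply: trap_three tr tW.
have [u v w z un e1 e2|x y z *|kA] := graph_shapeP sA A0.
- exact: square_three_graphs un e1 e2.
- by apply: (trap3 A B D x y z) => //; apply: triangle_traps.
have [u v w z un e1 e2|x y z *|kB] := graph_shapeP sB B0.
- by apply/perm1; apply: square_three_graphs un e1 e2.
- by apply/perm1; apply: (trap3 B A D x y z) => //; apply: triangle_traps.
have [u v w z un e1 e2|x y z *|kD] := graph_shapeP sD D0.
- by apply/perm2/perm1; apply: square_three_graphs un e1 e2.
- by apply/perm2/perm1; apply: (trap3 D A B x y z) => //; apply: triangle_traps.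
case: (kA) => [[K1 lK]|[a [b eA]]]; case: (kB) => [[L1 lL]|[c [d eB]]];
  case: (kD) => [[M1 lM]|[e [f eD]]].
- exact: three_stars.
- by rewrite eD; apply: two_stars_one_edge.
- by apply/perm2; rewrite eB; apply: two_stars_one_edge.
- by rewrite eB eD; apply: starlike_two_edges; rewrite -?eB.
- by apply/perm1/perm2; rewrite eA; apply: two_stars_one_edge.
- by apply/perm1; rewrite eA eD; apply: starlike_two_edges; rewrite -?eA.
- by apply/perm2/perm1; rewrite eA eB; apply: starlike_two_edges; rewrite -?eA.
- by rewrite eB eD; apply: starlike_two_edges; rewrite -?eB.
Qed.

End Graphs.

(** * Links and point degrees in triple systems *)

Section Links.
Variable T : finType.
Implicit Types (a b u x : T) (A C : {set T}) (F : {set {set T}}).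

Definition link F C a : {set {set T}} :=
  [set E : {set T} | [disjoint E & C] && (a |: E \in F)].

Lemma link_ksubsets F C a k : F \subset ksubsets T k.+1 -> a \in C ->
  link F C a \subset ksubsets T k.
Proof.
move=> sF aC; apply/subsetP=> E; rewrite !inE => /andP[dEC aEF].
have aE : a \notin E by rewrite (disjointFl dEC aC).
by have := ksubsets_card sF aEF; rewrite cardsU1 aE add1n => -[->].
Qed.

Lemma link_cross F C a b : intersecting F -> a \in C -> b \in C -> a != b ->
  cross_intersecting (link F C a) (link F C b).
Proof.
move=> iF aC bC nab E E'; rewrite !inE => /andP[dE aE] /andP[dE' bE'].
have /set0Pn[z] := iF _ _ aE bE'.
rewrite !inE => /andP[/orP[/eqP->|zE]]; rewrite ?(negPf nab) /=.
  by rewrite (disjointFl dE' aC).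
case/orP=> [/eqP zb|zE'].
  by move: zE; rewrite zb (disjointFl dE bC).
by apply/set0Pn; exists z; rewrite inE zE.
Qed.

Lemma trace_link F C a A : A \in F -> A :&: C = [set a] ->
  a \in A /\ A :\ a \in link F C a.
Proof.
move=> AF trA; have /setIP[aA aC] : a \in A :&: C by rewrite trA inE.
split=> //; rewrite inE setD1K // AF andbT.
rewrite disjoint_subset; apply/subsetP=> z; rewrite !inE => /andP[nza zA].
by apply/negP=> zC; move/setP/(_ z): trA; rewrite !inE zA zC (negPf nza).
Qed.

Lemma link_neq0 F C a A : A \in F -> A :&: C = [set a] -> link F C a != set0.
Proof. by move=> AF /(trace_link AF)[_ h]; apply/set0Pn; exists (A :\ a). Qed.

Lemma card_trace1 F C a u : u \notin C -> a \in C ->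
  #|[set A in F | (u \in A) && (A :&: C == [set a])]| <= degree (link F C a) u.
Proof.
move=> uC aC.
apply: leq_trans (leq_imset_card (fun E => a |: E) _).
apply/subset_leq_card/subsetP=> A; rewrite inE => /and3P[AF uA /eqP trA].
have [aA Al] := trace_link AF trA.
apply/imsetP; exists (A :\ a); last by rewrite setD1K.
by rewrite inE Al !inE uA andbT; apply: contraNneq uC => ->.
Qed.

(** The only candidate is C :\ a with u added. If it belongs to F it meets each
    a |: E with E in the link of a, and since E avoids C they can only meet
    in u. *)
Lemma card_trace2 F C a u : F \subset ksubsets T 3 -> intersecting F ->
  #|C| = 3 -> u \notin C -> a \in C ->
  #|[set A in F | (u \in A) && (A :&: C == C :\ a)]|
    <= (u \in kernel (link F C a)).
Proof.
move=> sF iF C3 uC aC; set S := [set A in F | _].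
have Ca2 : #|C :\ a| = 2 by move: C3; rewrite (cardsD1 a) aC => -[].
have S_eq A : A \in S -> A = u |: C :\ a.
  rewrite inE => /and3P[AF uA /eqP trA]; apply/esym/eqP.
  rewrite eqEcard subUset sub1set uA -trA subsetIl /= trA cardsU1.
  by rewrite !inE (negPf uC) andbF Ca2 (ksubsets_card sF AF).
case: bigcapP => [_|no].
  rewrite -[leqRHS]/1 -(cards1 (u |: C :\ a)).
  by apply/subset_leq_card/subsetP=> A /S_eq ->; rewrite inE.
rewrite leqn0 cards_eq0; apply/set0Pn=> -[A AS]; apply: no => E.
have eA := S_eq A AS; move: AS; rewrite 2!inE => /and3P[AF _ _] /andP[dE aEF].
have /set0Pn[z] := iF _ _ aEF AF.
rewrite eA !inE => /andP[/orP[/eqP->|zE]].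
  by rewrite eqxx orbF => /eqP au; rewrite -au aC in uC.
by case/orP=> [/eqP<- //|/andP[_ zC]]; rewrite (disjointFr dE zE) in zC.
Qed.

(** A member of F through u meets C in one or two of its three points; in the
    second case it is charged to the point of C that it misses. *)
Lemma degree_le_weights F C u : F \subset ksubsets T 3 -> intersecting F ->
  C \in F -> u \notin C -> degree F u <= \sum_(a in C) weight (link F C a) u.
Proof.
move=> sF iF CF uC; have C3 := ksubsets_card sF CF.
pose P a := [set A in F | (u \in A) && (A :&: C == [set a])].
pose Q a := [set A in F | (u \in A) && (A :&: C == C :\ a)].
apply: (@leq_trans #|\bigcup_(a in C) (P a :|: Q a)|); last first.
  apply: (@leq_trans (\sum_(a in C) #|P a :|: Q a|)).
    elim/big_ind2: _ => [|n1 S1 n2 S2 h1 h2|//]; first by rewrite cards0.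
    exact: card_setU_le.
  by apply: leq_sum => a aC; apply: card_setU_le;
    [apply: card_trace1 | apply: card_trace2].
apply/subset_leq_card/subsetP=> A; rewrite inE => /andP[AF uA].
have I0 : 0 < #|A :&: C| by rewrite card_gt0 iF.
have CA : #|C :\: A| + #|A :&: C| = 3 by rewrite addnC setIC cardsID.
have [I1|I2] : #|A :&: C| = 1 \/ #|C :\: A| = 1.
- have : 0 < #|C :\: A|; last by lia.
  rewrite card_gt0 setD_eq0; apply: contra uC => sCA.
  suff -> : C = A by [].
  by apply/eqP; rewrite eqEcard sCA C3 (ksubsets_card sF AF).
- have /eqP/cards1P[a Ia] := I1.
  have /setIP[aA aC] : a \in A :&: C by rewrite Ia inE.
  by apply/bigcupP; exists a; rewrite // !inE AF uA Ia eqxx.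
have /eqP/cards1P[a Da] := I2.
have /setDP[aC aA] : a \in C :\: A by rewrite Da inE.
apply/bigcupP; exists a => //; rewrite !inE AF uA /=; apply/orP; right.
by rewrite -Da setDDr setDv set0U setIC.
Qed.

Lemma card_setC_ge C m k : #|C| <= m -> m + k <= #|T| -> k <= #|~: C|.
Proof. by move=> Cm; rewrite -(cardsC C); lia. Qed.

Lemma setI_pair A a b : a \in A -> b \notin A -> A :&: [set a; b] = [set a].
Proof.
move=> aA bA; apply/setP=> z; rewrite !inE.
case: (z =P a) => [->|_]; first by rewrite aA.
by case: (z =P b) => [->|_]; rewrite ?(negPf bA) ?andbF.
Qed.

(** Non-triviality provides members of F avoiding a, and members avoiding b, so
    both links are nonempty. *)
Lemma two_cover_degree F a b : F \subset ksubsets T 3 -> intersecting F ->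
  (forall x, exists2 A, A \in F & x \notin A) -> 7 <= #|T| ->
  a != b -> {in F, forall A, A :&: [set a; b] != set0} ->
  exists u, degree F u <= 3.
Proof.
move=> sF iF miss T7 nab cov; set C := [set a; b].
have aC : a \in C by rewrite !inE eqxx.
have bC : b \in C by rewrite !inE eqxx orbT.
have [A AF bA] := miss b; have [B BF aB] := miss a.
have trA : A :&: C = [set a].
  apply: (setI_pair _ bA).
  by have := meets_pair (cov A AF); rewrite (negPf bA) orbF.
have trB : B :&: C = [set b].
  rewrite /C setUC; apply: (setI_pair _ aB).
  by have := meets_pair (cov B BF); rewrite (negPf aB).
have [u] := two_graphs (link_ksubsets sF aC) (link_ksubsets sF bC)
  (link_neq0 AF trA) (link_neq0 BF trB) (link_cross iF aC bC nab)
  (card_setC_ge (card_set2_le a b) T7).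
rewrite inE => uC du; exists u.
have [nua nub] : u != a /\ u != b.
  by move: uC; rewrite set2_notin => /andP[].
pose P x := [set A in F | (u \in A) && (A :&: C == [set x])].
apply: (@leq_trans #|P a :|: P b :|: [set [set a; b; u]]|); last first.
  apply: (@leq_trans (degree (link F C a) u + degree (link F C b) u + 1)).
    by apply: card_setU_le; rewrite ?cards1 //; apply: card_setU_le;
      apply: card_trace1.
  by rewrite -[3]/(2 + 1) leq_add2r.
apply/subset_leq_card/subsetP=> S; rewrite !inE => /andP[SF uS].
rewrite SF uS /=; have := meets_pair (cov S SF).
case: (boolP (a \in S)) => aS; case: (boolP (b \in S)) => bS //= _.
- apply/orP; right; rewrite eq_sym eqEcard (ksubsets_card sF SF).
  have -> : #|[set a; b; u]| = 3.
    by rewrite card_set3.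
  by rewrite leqnn andbT !subUset !sub1set aS bS uS.
- by rewrite setI_pair ?eqxx.
- by rewrite {2}/C setUC setI_pair ?eqxx ?orbT.
Qed.

(** For C = {x, y, z} in F, some member avoids y and z; as it meets C, its trace
    on C is {x}, so the link of x is nonempty. *)
Lemma no_two_cover_degree F : F \subset ksubsets T 3 -> intersecting F ->
  F != set0 -> 7 <= #|T| ->
  (forall a b, a != b -> exists2 A, A \in F & A :&: [set a; b] = set0) ->
  exists u, degree F u <= 3.
Proof.
move=> sF iF /set0Pn[C CF] T7 miss; have C3 := ksubsets_card sF CF.
have /card_gt2P[a [b [c [[aC bC cC] [nab nbc nca]]]]] : 2 < #|C| by rewrite C3.
have eC : C = a |: (b |: [set c]).
  apply/esym/eqP; rewrite eqEcard !subUset !sub1set aC bC cC C3 /=.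
  by rewrite cardsU1 cards2 nbc !inE negb_or nab eq_sym nca.
have nac : a != c by rewrite eq_sym.
have link0 x y z : C = x |: (y |: [set z]) -> y != z -> link F C x != set0.
  move=> exyz nyz; have [A AF A0] := miss y z nyz.
  apply: (link_neq0 AF); apply/eqP; rewrite eqEsubset.
  have I0 : A :&: C != set0 by apply: iF.
  have sI : A :&: C \subset [set x].
    by rewrite exyz setIUr [A :&: [set y; z]]A0 setU0 subsetIr.
  rewrite sI /=; have /set0Pn[t tI] := I0.
  have := subsetP sI t tI; rewrite inE => /eqP tx.
  by rewrite sub1set -tx.
have [||||||||||u uC du] := @three_graphs T (link F C a) (link F C b) (link F C c) (~: C).
- exact: link_ksubsets.
- exact: link_ksubsets.
- exact: link_ksubsets.
- exact: link0 eC nbc.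
- by apply: (link0 b a c) => //; rewrite eC setUCA.
- by apply: (link0 c a b) => //; rewrite eC setUA setUC.
- exact: link_cross.
- exact: link_cross.
- exact: link_cross.
- by apply: (@card_setC_ge C 3); rewrite ?C3.
rewrite inE in uC; exists u.
apply: leq_trans (degree_le_weights sF iF CF uC) _.
rewrite {1}eC big_setU1 /=; last by rewrite !inE negb_or nab.
by rewrite big_setU1 /= ?inE // big_set1 addnA.
Qed.

Lemma nontrivial_degree F : F \subset ksubsets T 3 ->
  nontrivial_intersecting 3 F -> 7 <= #|T| -> exists u, degree F u <= 3.
Proof.
move=> sF [iF ntF] T7.
have miss x : exists2 A, A \in F & x \notin A.
  apply/exists_inP; apply: contraPT ntF; rewrite negb_exists_in.
  move=> /forall_inP h; apply; exists x; apply/subsetP=> A AF.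
  by rewrite inE (subsetP sF A AF) -[_ \in _]negbK h.
case: (boolP [exists a, exists b, (a != b) &&
    [forall A in F, A :&: [set a; b] != set0]]) => [|nocov].
  case/existsP=> a /existsP[b /andP[nab /forall_inP cov]].
  exact: two_cover_degree cov.
apply: no_two_cover_degree => //.
  have /card_gt0P[x _] : 0 < #|T| by apply: leq_trans T7.
  by have [A AF _] := miss x; apply/set0Pn; exists A.
move=> a b nab; have /existsPn/(_ a)/existsPn/(_ b) := nocov.
rewrite nab /= negb_forall_in => /exists_inP[A AF].
by rewrite negbK => /eqP; exists A.
Qed.

Lemma min_degree_le F u : min_degree F <= degree F u.
Proof. exact: (@Order.TotalTheory.bigmin_le _ nat). Qed.

End Links.

(** * The Hilton-Milner family *)

Section HM.
Variable T : finType.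
Implicit Types (s u x y : T) (S A : {set T}).

Lemma set3_inj u x y1 y2 : y1 != x -> y1 != u ->
  [set x; u; y1] = [set x; u; y2] -> y1 = y2.
Proof.
move=> nx nu /setP/(_ y1); rewrite !inE eqxx orbT (negPf nx) (negPf nu) /=.
by move/esym/eqP.
Qed.

Lemma degree_ge_pair (F : {set {set T}}) x u (Y : {set T}) v : v \in [set x; u] ->
  x \notin Y -> u \notin Y -> (forall y, y \in Y -> [set x; u; y] \in F) ->
  #|Y| <= degree F v.
Proof.
move=> vxu xY uY YF.
rewrite -(@card_in_imset _ _ (fun y => [set x; u; y]) Y); last first.
  move=> y1 y2 y1Y y2Y; apply: set3_inj.
    by apply: contraNneq xY => <-.
  by apply: contraNneq uY => <-.
apply/subset_leq_card/subsetP=> A /imsetP[y yY ->]; rewrite inE YF //=.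
by rewrite inE vxu.
Qed.

Lemma HM_triple S x s y : s \in S -> x \notin S -> y != x -> y != s ->
  [set x; s; y] \in HM_family 3 S x.
Proof.
move=> sS xS nyx nys; rewrite inE; apply/orP; right.
have nxs : x != s by apply: contraNneq xS => ->.
rewrite !inE eqxx /= andbC; apply/andP; split.
  by apply/set0Pn; exists s; rewrite !inE eqxx orbT.
by rewrite card_set3.
Qed.

(** A point s of S, and x itself, lie in the triple {x, s, y} for each of the at
    least five other points y; a point u outside S and different from x has only
    the three triples {x, u, s}. *)
Lemma HM_min_degree S x : 7 <= #|T| -> #|S| = 3 -> x \notin S ->
  min_degree (HM_family 3 S x) = 3.
Proof.
move=> T7 S3 xS; apply/eqP; rewrite eqn_leq; apply/andP; split.
  have [u _ uS] : exists2 u, u \in [set: T] & u \notin x |: S.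
    apply: exists_outside; rewrite cardsT cardsU1 xS S3; exact: leq_trans T7.
  apply: leq_trans (min_degree_le _ u) _.
  move: uS; rewrite in_setU1 negb_or => /andP[nux uS].
  rewrite -[leqRHS]S3; apply: leq_trans (leq_imset_card (fun s => [set x; u; s]) S).
  apply/subset_leq_card/subsetP=> A; rewrite !inE => /andP[/orP[/eqP eA|]].
    by rewrite eA (negPf uS).
  case/and3P=> /eqP A3 xA /set0Pn[s /setIP[sA sS]] uA.
  apply/imsetP; exists s => //; apply/esym/eqP.
  rewrite eqEcard !subUset !sub1set xA uA sA A3 /=.
  have nxu : x != u by rewrite eq_sym.
  have nsx : s != x by apply: contraNneq xS => <-.
  have nsu : s != u by apply: contraNneq uS => <-.
  by rewrite card_set3.
have deg_ge u : 3 <= degree (HM_family 3 S x) u.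
  have near s v : s \in S -> v \in [set x; s] -> 3 <= degree (HM_family 3 S x) v.
    move=> sS vxs; apply: (@leq_trans #|~: [set x; s]|).
      by apply: (card_setC_ge (card_set2_le x s)); apply: leq_trans T7.
    apply: degree_ge_pair vxs _ _ _; rewrite ?inE ?eqxx ?orbT //.
    by move=> y; rewrite inE set2_notin => /andP[? ?]; apply: HM_triple.
  have /card_gt0P[s sS] : 0 < #|S| by rewrite S3.
  case: (eqVneq u x) => [->|nux]; first by apply: near sS _; rewrite !inE eqxx.
  case: (boolP (u \in S)) => uS; first by apply: near uS _; rewrite !inE eqxx orbT.
  apply: (@leq_trans #|S|); first by rewrite S3.
  apply: (degree_ge_pair (x := x) (u := u)) => //.
    by rewrite !inE eqxx orbT.
  move=> y yS; rewrite setUAC; apply: HM_triple => //.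
  by apply: contraNneq uS => ->.
rewrite /min_degree; elim/big_ind: _ => [|m1 m2 h1 h2|u _] //.
  apply: leq_trans (deg_ge x) _.
  by apply/subset_leq_card/subsetP=> A; rewrite inE => /andP[].
by rewrite leq_min h1.
Qed.

End HM.

Theorem proposition2 (n : nat) (F HM : {set {set 'I_n}}) :
  7 <= n ->
  F \subset ksubsets 'I_n 3 ->
  nontrivial_intersecting 3 F ->
  is_HM 3 HM ->
  min_degree F <= min_degree HM /\ min_degree HM = 3.
Proof.
move=> n7 sF ntF [S [x [S3 xS ->]]].
have T7 : 7 <= #|'I_n| by rewrite card_ord.
have -> : min_degree (HM_family 3 S x) = 3.
  by apply: HM_min_degree => //; move: S3; rewrite inE => /eqP.
split=> //; have [u du] := nontrivial_degree sF ntF T7.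
exact: leq_trans (min_degree_le F u) du.
Qed.
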